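(* Let $\eta\in\{321,312\}$. Then $$\liminf_{n\to\infty}\ \max_{M\in\{0,\dots,n-1\}}P_n^{\text{av}(\eta)}\big(W_{\mathcal{S}(n,M)}\big)\ge\frac{7}{16}.$$
   Context: $S_n$ is the set of permutations $\sigma=\sigma_1\cdots\sigma_n$ of $[n]=\{1,\dots,n\}$. In the secretary problem, $n$ items with ranks $1,\dots,n$ arrive one at a time, $\sigma_i$ being the rank of the $i$th item to arrive; $n$ is the highest rank. The observer sees only the relative ranks of the items that have arrived so far. For $M\in\{0,1,\dots,n-1\}$, the strategy $\mathcal{S}(n,M)$ is: reject the first $M$ items, then select the first later-arriving item whose rank is higher than that of each of the first $M$ items, if such an item exists (for $M=0$, this means the first item is selected). $W_{\mathcal{S}(n,M)}\subset S_n$ is the event that the observer using $\mathcal{S}(n,M)$ selects the item of rank $n$. Pattern avoidance: for $\eta=\eta_1\eta_2\eta_3\in S_3$ and $\sigma\in S_n$ ($n\ge3$), $\sigma$ contains $\eta$ if there are indices $1\le i_1<i_2<i_3\le n$ such that for all $1\le j,k\le 3$, $\sigma_{i_j}<\sigma_{i_k}$ if and only if $\eta_j<\eta_k$; otherwise $\sigma$ avoids $\eta$. $S_n^{\text{av}(\eta)}$ is the set of $\sigma\in S_n$ avoiding $\eta$, and $P_n^{\text{av}(\eta)}$ is the uniform probability measure on $S_n^{\text{av}(\eta)}$. *)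

(* Defs.v *)
From mathcomp Require Export all_boot all_order all_fingroup all_algebra.
From mathcomp Require Export reals ereal sequences.

Set Implicit Arguments.
Unset Strict Implicit.
Unset Printing Implicit Defensive.

Import Order.TTheory GRing.Theory Num.Theory.

Local Open Scope ring_scope.

(* Positions and ranks are numbered from 0 in ['S_n]: the i-th item is the
   position of value i - 1, and [rank] shifts the value back to {1, ..., n}. *)
Definition rank (n : nat) (s : 'S_n) (i : 'I_n) : nat := (s i).+1.

Definition one_line (n : nat) (s : 'S_n) : seq nat :=
  [seq rank s i | i <- enum 'I_n].

Definition contains (k n : nat) (eta : 'S_k) (s : 'S_n) : bool :=
  [exists f : {ffun 'I_k -> 'I_n},
    [forall j : 'I_k, forall l : 'I_k, (j < l)%N ==> (f j < f l)%N] &&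
    [forall j : 'I_k, forall l : 'I_k,
       (rank s (f j) < rank s (f l))%N == (rank eta j < rank eta l)%N]].

Definition Sav (k n : nat) (eta : 'S_k) : {set 'S_n} :=
  [set s : 'S_n | ~~ contains eta s].

(* [enum 'I_n] lists the positions in order of arrival, so the head of the
   filtered list is the first eligible item; [None] if nothing is selected. *)
Definition selected (n M : nat) (s : 'S_n) : option 'I_n :=
  ohead [seq i : 'I_n <- enum 'I_n |
    (M <= i)%N && [forall j : 'I_n, (j < M)%N ==> (rank s j < rank s i)%N]].

Definition W (n M : nat) : {set 'S_n} :=
  [set s : 'S_n | if selected M s is Some i then rank s i == n else false].

Definition Pav (R : realType) (k n : nat) (eta : 'S_k) (A : {set 'S_n}) : R :=
  #|A :&: Sav n eta|%:R / #|Sav n eta|%:R.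

(* Main.v *)
Require Import Defs.
From mathcomp Require Import zify ring normedtype.

(** The strategy that rejects all but the last two items already wins with
probability at least 7/16, for every n >= 2 and both patterns.

Let c_n be the number of avoiders in S_n.  In 321 and 312 the maximum comes
first and has two entries after it, so putting the value n in one of the last
two positions of an avoider of S_(n-1) never creates the pattern.  With
M = n - 2 the observer wins when n stands last but one, which gives c_(n-1)
avoiders, and when n stands last unless n - 1 stands just before it, which gives
c_(n-1) - c_(n-2) avoiders ([card_W_ge]).

It remains to see that the c_n are the Catalan numbers.  Both patterns consist
of a maximum followed by a pair in a given direction, so an avoider of S_(n+1)
is an avoider of S_n together with a place i for the maximum such that no pair
in that direction occurs from position i on ([avoids_insert_max]).  This suggests
counting the avoiders t(n, m) of S_n without such a pair from position m on.
The way in which the places of the maximum distribute differs between the two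
patterns, but the count satisfies t(n+1, m) = t(n, 0) + ... + t(n, m) for both
([nb_tailS]).  Its solution is the ballot number C(n+m, n) - C(n+m, n+1)
([nb_tail_ballot]), and m = n gives (n+2) c_(n+1) = 2 (2n+1) c_n
([nb_avoidsS]).

With this recurrence, 16 (2 c_(n-1) - c_(n-2)) >= 7 c_n is an inequality between
polynomials in n ([nb_avoids_lower_bound]).  The ratio tends to
2/4 - 1/16 = 7/16, but since the bound holds for each n, the limit inferior
requires no asymptotic estimate. *)

Set Implicit Arguments.
Unset Strict Implicit.
Unset Printing Implicit Defensive.
Import Order.TTheory GRing.Theory Num.Theory.
Local Open Scope ring_scope.

(** * Patterns with a leading maximum *)

(** The direction [up] of the last two entries selects the pattern:
312 if [up] is true, 321 if it is false. *)
Definition avoids (up : bool) {n : nat} (s : 'S_n) : bool :=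
  [forall a : 'I_n, forall b : 'I_n, forall c : 'I_n,
    (a < b < c)%N && (s b < s a)%N && (s c < s a)%N ==> ((s b < s c)%N != up)].

Lemma avoidsP up n (s : 'S_n) :
  reflect (forall a b c : 'I_n, (a < b)%N -> (b < c)%N -> (s b < s a)%N ->
             (s c < s a)%N -> (s b < s c)%N != up)
          (avoids up s).
Proof.
apply: (iffP forallP) => [H a b c ab bc ba ca | H a].
  by have /forallP/(_ b)/forallP/(_ c)/implyP := H a; apply; rewrite ab bc ba.
apply/forallP => b; apply/forallP => c; apply/implyP.
by move=> /andP[/andP[/andP[ab bc] ba] ca]; apply: (H a).
Qed.

Lemma containsE up (eta : 'S_3) n (s : 'S_n) :
  one_line eta = [:: 3; (~~ up).+1; up.+1]%N -> contains eta s = ~~ avoids up s.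
Proof.
rewrite /one_line /rank !enum_ordSl enum_ord0 /=.
set i0 : 'I_3 := ord0; set i1 : 'I_3 := lift _ _; set i2 : 'I_3 := lift _ _.
case=> e0 e1 e2; apply/existsP/idP => [[f /andP[/forallP fmon /forallP fpat]]|].
  have mon (j l : 'I_3) : (j < l)%N -> (f j < f l)%N.
    by move=> jl; have /forallP/(_ l)/implyP := fmon j; apply.
  have pat (j l : 'I_3) : (s (f j) < s (f l))%N = (eta j < eta l)%N.
    by have /forallP/(_ l)/eqP := fpat j; rewrite /rank !ltnS.
  apply/negP => /avoidsP/(_ (f i0) (f i1) (f i2)).
  rewrite !mon // !pat e0 e1 e2 => /(_ isT isT).
  by case: (up) => /(_ isT isT).
(* Conversely, an occurrence a < b < c embeds the three positions as (a; b; c). *)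
rewrite /avoids negb_forall => /existsP[a]; rewrite negb_forall => /existsP[b].
rewrite negb_forall => /existsP[c]; rewrite negb_imply negbK.
move=> /andP[/andP[/andP[/andP[ab bc] ba] ca] /eqP bcup].
exists [ffun j : 'I_3 => tnth [tuple a; b; c] j].
have ac := ltn_trans ab bc.
have cb : (s c < s b)%N = ~~ up.
  rewrite -bcup ltnNge leq_eqVlt; case: eqP => //= /val_inj/perm_inj E.
  by move: bc; rewrite E ltnn.
apply/andP; split; apply/forallP => j; apply/forallP => l; rewrite !ffunE.
  by case: j => [[|[|[|j]]] ?] //; case: l => [[|[|[|l]]] ?].
have dom (k : 'I_3) : [\/ k = i0, k = i1 | k = i2].
  by case: k => [[|[|[|k]]] ?] //;
    [apply: Or31|apply: Or32|apply: Or33]; apply: val_inj.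
rewrite /rank !ltnS.
by case: (dom j) => ->; case: (dom l) => ->; rewrite ?ltnn ?e0 ?e1 ?e2 /tnth /=
  ?ltnn ?bcup ?cb ?ba ?ca ?[in (s a < _)%N]ltnNge ?(ltnW ba) ?(ltnW ca) //;
  case: (up).
Qed.

Definition tail_avoids (up : bool) (m : nat) {n : nat} (s : 'S_n) : bool :=
  [forall b : 'I_n, forall c : 'I_n,
    (m <= b < c)%N ==> ((s b < s c)%N != up)].

Lemma tail_avoidsP up m n (s : 'S_n) :
  reflect (forall b c : 'I_n, (m <= b)%N -> (b < c)%N -> (s b < s c)%N != up)
          (tail_avoids up m s).
Proof.
apply: (iffP forallP) => [H b c mb bc | H b].
  by have /forallP/(_ c)/implyP := H b; apply; rewrite mb.
by apply/forallP => c; apply/implyP => /andP[mb bc]; apply: H.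
Qed.

Lemma tail_avoids_short up m n (s : 'S_n) : (n <= m.+1)%N -> tail_avoids up m s.
Proof. by move=> nm; apply/tail_avoidsP => b c mb bc; have := ltn_ord c; lia. Qed.

(** * Inserting the maximum *)

Definition insert_max {n} (i : 'I_n.+1) (s : 'S_n) : 'S_n.+1 :=
  lift_perm i ord_max s.

Lemma insert_max_at n (i : 'I_n.+1) (s : 'S_n) : insert_max i s i = n :> nat.
Proof. by rewrite /insert_max lift_perm_id. Qed.

Lemma insert_max_lift n (i : 'I_n.+1) (s : 'S_n) (j : 'I_n) :
  insert_max i s (lift i j) = s j :> nat.
Proof. by rewrite /insert_max lift_perm_lift lift_max. Qed.

Lemma ltn_lift n (i : 'I_n.+1) (a b : 'I_n) :
  (lift i a < lift i b)%N = (a < b)%N.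
Proof. by rewrite !ltnNge leq_bump2. Qed.

(** The new maximum can only play the leading entry of the pattern, and then the
other two entries are any pair after it in direction [up]. *)
Lemma avoids_insert_max up n (i : 'I_n.+1) (s : 'S_n) :
  avoids up (insert_max i s) = avoids up s && tail_avoids up i s.
Proof.
apply/avoidsP/andP => [H|[/avoidsP Hav /tail_avoidsP Ht] a b c].
  split; first apply/avoidsP => a b c ab bc ba ca.
    have := H (lift i a) (lift i b) (lift i c).
    by rewrite !ltn_lift !insert_max_lift; apply.
  apply/tail_avoidsP => b c ib bc.
  have := H i (lift i b) (lift i c).
  rewrite !ltn_lift !insert_max_at !insert_max_lift !ltn_ord; apply=> //.
  by rewrite /= /bump ib ltnS.
case: (unliftP i a) => [a'|] ->; case: (unliftP i b) => [b'|] ->;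
  case: (unliftP i c) => [c'|] ->;
  rewrite ?ltn_lift ?insert_max_at ?insert_max_lift ?ltnn //.
- exact: Hav.
- by move=> _ _ _; rewrite ltnNge ltnW.
- by move=> _ _; rewrite ltnNge ltnW.
- by move=> ib bc _ _; apply: Ht => //; move: ib; rewrite /= /bump; lia.
Qed.

(** No pair of [s] in direction [up] lies from i on, so only pairs with the maximum, or
pairs that lie from m on but start before i, matter. For 312 a maximum at i > m
ends an ascent started by its left neighbour, while for i <= m it only starts
descents. For 321 it starts a descent that lies from m on unless i < m or i is
the last position; in the last position it creates no descent, and the pairs of
[s] from m on remain to be examined. *)
Lemma tail_avoids_insert_max up n m (i : 'I_n.+1) (s : 'S_n) : (m <= n)%N ->
  tail_avoids up i s ->
  tail_avoids up m (insert_max i s) =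
    if up then (i <= m)%N
    else (i < m)%N || ((i == ord_max) && tail_avoids up m s).
Proof.
move=> mn /tail_avoidsP Hi; case: up Hi => Hi.
  apply/tail_avoidsP/idP => [H|im b c mb bc].
    rewrite leqNgt; apply/negP => mi.
    have bn : (i.-1 < n)%N by have := ltn_ord i; lia.
    have := H (lift i (Ordinal bn)) i; rewrite insert_max_at insert_max_lift ltn_ord.
    by rewrite /= /bump => /(_ ltac:(lia) ltac:(lia)).
  move: mb bc; case: (unliftP i b) => [b'|] ->; case: (unliftP i c) => [c'|] ->;
    rewrite ?ltn_lift ?insert_max_at ?insert_max_lift //.
  - by move=> mb bc; apply: Hi => //; move: mb; rewrite /= /bump; lia.
  - by rewrite /= /bump => mb; lia.
  - by move=> _ _; rewrite ltnNge ltnW.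
  - by rewrite ltnn.
apply/tail_avoidsP/orP => [H|im b c].
  case: (ltnP i m) => [|mi]; [by left|right].
  have iE : i = ord_max.
    apply/eqP; rewrite -val_eqE eqn_leq -ltnS ltn_ord /= leqNgt.
    apply/negP => ni.
    have := H i (lift i (Ordinal ni)); rewrite insert_max_at insert_max_lift.
    have -> : (n < s (Ordinal ni))%N = false by rewrite ltnNge ltnW.
    move=> H'; have: false by apply: H' => //; rewrite /= /bump leqnn.
    by [].
  rewrite {}iE eqxx /= in H *; apply/tail_avoidsP => b c mb bc.
  have := H (lift ord_max b) (lift ord_max c).
  by rewrite ltn_lift !insert_max_lift lift_max; apply.
case: (unliftP i b) => [b'|] ->; case: (unliftP i c) => [c'|] ->;
    rewrite ?ltn_lift ?insert_max_at ?insert_max_lift ?ltnn ?ltn_ord //.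
- move=> mb bc; case: im => [im|/andP[/eqP iE /tail_avoidsP Ht]].
    by apply: Hi => //; move: mb; rewrite /= /bump; lia.
  by apply: Ht => //; move: mb; rewrite iE lift_max.
- case: im => [im|/andP[/eqP iE _]] mi; first by lia.
  by rewrite iE lift_max /= ltnNge ltnW // (ltn_ord c').
Qed.

(** Inserting the maximum is injective on pairs (place, permutation), hence
bijective since both sides have (n+1)! elements. *)
Lemma card_insert_max n (P : pred 'S_n.+1) :
  #|[set s | P s]| = (\sum_(i < n.+1) #|[set s | P (insert_max i s)]|)%N.
Proof.
pose f (p : 'I_n.+1 * 'S_n) := insert_max p.1 p.2.
have f_inj : injective f.
  move=> [i s] [j t] /= E.
  have ij : i = j.
    apply: (@perm_inj _ (insert_max i s)); rewrite {2}[insert_max i s]E.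
    by apply: val_inj; rewrite /= !insert_max_at.
  subst j; congr (_, _); apply/permP => x; apply: val_inj.
  by rewrite /= -(insert_max_lift i s) -(insert_max_lift i t) [insert_max i s]E.
have f_bij : bijective f.
  apply: inj_card_bij f_inj _.
  by rewrite card_prod !card_ord !card_Sn factS.
rewrite -sum1dep_card (reindex f) /=; last exact: onW_bij.
rewrite -(pair_big_dep xpredT (fun i s => P (insert_max i s)) (fun _ _ => 1%N)) /=.
by apply: eq_bigr => i _; rewrite sum1dep_card.
Qed.

(** * Enumeration by ballot numbers *)

Definition nb_tail up n m : nat :=
  #|[set s : 'S_n | avoids up s && tail_avoids up m s]|.
Definition nb_avoids up n : nat := #|[set s : 'S_n | avoids up s]|.

Lemma nb_tail_short up n m : (n <= m.+1)%N -> nb_tail up n m = nb_avoids up n.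
Proof.
move=> nm; apply: eq_card => s; rewrite !inE; case: avoids => //=.
exact: tail_avoids_short.
Qed.

(** For 312 the maximum goes to the places i <= m, each contributing t(n, i). For
321 it goes to the places i < m or to the end, and the end contributes the
missing t(n, m), because appending the maximum leaves the condition on the tail
unchanged. *)
Lemma nb_tailS up n m : (m <= n)%N ->
  nb_tail up n.+1 m = (\sum_(i < m.+1) nb_tail up n i)%N.
Proof.
move=> mn; rewrite /nb_tail card_insert_max.
pose F (i : 'I_n.+1) := #|[set s : 'S_n | avoids up s && tail_avoids up i s &&
   (if up then (i <= m)%N else (i < m)%N ||
      ((i == ord_max) && tail_avoids up m s))]|.
rewrite (eq_bigr F); last first.
  move=> i _; apply: eq_card => s; rewrite !inE avoids_insert_max.
  case: avoids => //=; case: (boolP (tail_avoids up i s)) => //= Hi.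
  by rewrite tail_avoids_insert_max.
case: up @F => F.
  rewrite (big_ord_widen n.+1 (fun i => nb_tail true n i)) // [RHS]big_mkcond.
  apply: eq_bigr => i _; rewrite /F ltnS.
  case: leqP => im; last by apply: eq_card0 => s; rewrite !inE andbF.
  by apply: eq_card => s; rewrite !inE andbT.
rewrite big_ord_recr [RHS]big_ord_recr /=; congr (_ + _)%N.
  rewrite (big_ord_widen n (fun i => nb_tail false n i)) // [RHS]big_mkcond.
  apply: eq_bigr => i _; rewrite /F /= -val_eqE /= ltn_eqF //= orbF.
  case: ltnP => im; last by apply: eq_card0 => s; rewrite !inE andbF.
  by apply: eq_card => s; rewrite !inE andbT.
apply: eq_card => s; rewrite !inE ltnNge mn eqxx /=; case: avoids => //=.
by rewrite tail_avoids_short.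
Qed.

(** The recurrence is summed by Pascal's rule. The value m = n + 1 for S_(n+1) is
outside its range, but the last two tails, of lengths 0 and 1, are both
unconstrained, so it agrees with m = n. *)
Lemma nb_tail_ballot up n m : (m <= n)%N ->
  (nb_tail up n m + 'C(n + m, n.+1) = 'C(n + m, n))%N.
Proof.
elim: n m => [|n IHn] m.
  rewrite leqn0 => /eqP ->; rewrite nb_tail_short // /nb_avoids.
  have -> : [set s : 'S_0 | avoids up s] = setT.
    by apply/setP => s; rewrite !inE; apply/avoidsP => -[].
  by rewrite cardsT card_Sn.
(* The case m = n + 1 follows from m = n and 'C(2n+1, n) = 'C(2n+1, n+1). *)
suff H k : (k <= n)%N ->
    (nb_tail up n.+1 k + 'C(n.+1 + k, n.+2) = 'C(n.+1 + k, n.+1))%N.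
  rewrite leq_eqVlt ltnS => /orP[/eqP ->|]; last exact: H.
  have := H n (leqnn n); rewrite !nb_tail_short // addnS addSn.
  have E : 'C((n + n).+1, n.+1) = 'C((n + n).+1, n).
    by rewrite -[LHS]bin_sub; [congr binomial; lia | lia].
  by rewrite (binS _.+1 n.+1) (binS _.+1 n) -E; lia.
move=> kn; rewrite nb_tailS //; elim: k kn => [|k IHk] kn.
  have := IHn 0%N (leq0n n); rewrite big_ord1 !addn0 !binn.
  by rewrite (bin_small (ltnSn n)) (bin_small (ltnSn n.+1)) addn0.
rewrite big_ord_recr /=.
have := IHk (ltnW kn); have := IHn k.+1 kn.
rewrite (addnS n.+1 k) (addnS n k) -(addSn n k).
by rewrite (binS (n.+1 + k) n.+1) (binS (n.+1 + k) n) => <- <-; ring.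
Qed.

Lemma nb_avoids_bin up n : (n.+1 * nb_avoids up n = 'C(n + n, n))%N.
Proof.
have := nb_tail_ballot up (leqnn n); rewrite nb_tail_short //.
by have := mul_bin_left (n + n) n; rewrite addnK; nia.
Qed.

Lemma nb_avoidsS up n :
  (n.+2 * nb_avoids up n.+1 = 2 * (2 * n).+1 * nb_avoids up n)%N.
Proof.
apply/eqP; rewrite -(eqn_pmul2l (ltn0Sn n)); apply/eqP.
rewrite nb_avoids_bin mulnCA nb_avoids_bin addnS binS addSn.
have -> : 'C((n + n).+1, n) = 'C((n + n).+1, n.+1).
  by rewrite -bin_sub; [congr binomial; lia | lia].
by have := mul_bin_diag (n + n).+1 n; rewrite /=; nia.
Qed.

Lemma nb_avoids_gt0 up n : (0 < nb_avoids up n)%N.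
Proof.
by rewrite -(@ltn_pmul2l n.+1) // muln0 nb_avoids_bin bin_gt0 leq_addr.
Qed.

(** Writing b = 2(2p+1)/(p+2) a and c = 2(2p+3)/(p+3) b, the difference of the
two sides is, up to a positive factor, linear in p with positive
coefficients. *)
Lemma nb_avoids_lower_bound up p :
  (7 * nb_avoids up p.+2 + 16 * nb_avoids up p <= 32 * nb_avoids up p.+1)%N.
Proof.
have := nb_avoidsS up p; have := nb_avoidsS up p.+1.
move: (nb_avoids up p.+2) (nb_avoids up p.+1) (nb_avoids up p) => c b a Ec Eb.
rewrite -(leq_pmul2l (_ : (0 < (p + 2) * (p + 3))%N)); last by lia.
nia.
Qed.

(** * Winning permutations *)

Lemma ohead_filterE (T : eqType) (a : pred T) (x : T) (s : seq T) :
  x \in s -> a x -> (forall y, (index y s < index x s)%N -> ~~ a y) ->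
  ohead [seq y <- s | a y] = Some x.
Proof.
elim: s => //= y s IHs; rewrite inE eq_sym; case: eqP => [-> _ -> //|_] /= xs ax H.
have /negbTE-> : ~~ a y by apply: (H y); rewrite eqxx.
apply: IHs => // z zx; apply: H; by case: eqP.
Qed.

(** The item of highest rank is selected as soon as each item that arrives
between the first M items and it is dominated by one of the first M. *)
Lemma mem_W n M (s : 'S_n) (i : 'I_n) :
  (s i).+1 = n -> (M <= i)%N ->
  (forall j : 'I_n, (M <= j < i)%N ->
     exists2 k : 'I_n, (k < M)%N & (s j < s k)%N) ->
  s \in W n M.
Proof.
move=> si Mi H; rewrite inE /selected (@ohead_filterE _ _ i) ?mem_enum //.
- by rewrite /rank si.
- rewrite Mi /=; apply/forallP => j; apply/implyP => jM.
  rewrite /rank ltnS ltn_neqAle -(ltnS (s j)) si ltn_ord andbT.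
  apply/negP => /eqP E; have /perm_inj ji : s j = s i by apply: val_inj.
  by move: jM; rewrite ji ltnNge Mi.
- move=> j; rewrite !index_enum_ord => ji; apply/negP => /andP[Mj /forallP Hj].
  have [|k kM jk] := H j; first by rewrite Mj.
  by have := Hj k; rewrite kM /rank ltnS ltnNge ltnW.
Qed.

(** A final maximum belongs to no occurrence of the pattern and can be removed. *)
Lemma card_avoids_max_last up p :
  #|[set s : 'S_p.+1 | avoids up s && (s ord_max == ord_max)]| = nb_avoids up p.
Proof.
rewrite card_insert_max big_ord_recr /= big1 ?add0n => [|i _].
  apply: eq_card => s; rewrite !inE avoids_insert_max tail_avoids_short //.
  by rewrite -val_eqE /= insert_max_at eqxx !andbT.
apply: eq_card0 => s; rewrite !inE -val_eqE /=; apply/negP => /andP[_ /eqP E].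
pose j := widen_ord (leqnSn p) i.
have /perm_inj/(congr1 val)/= Ei : insert_max j s ord_max = insert_max j s j.
  by apply: val_inj; rewrite /= [LHS]E insert_max_at.
by have := ltn_ord i; lia.
Qed.

Lemma card_W_ge up p :
  (2 * nb_avoids up p.+1 <=
     #|W p.+2 p :&: [set s | avoids up s]| + nb_avoids up p)%N.
Proof.
have -> : W p.+2 p :&: [set s | avoids up s] =
    [set s | (s \in W p.+2 p) && avoids up s].
  by apply/setP => s; rewrite !inE.
rewrite card_insert_max !big_ord_recr /= -(card_avoids_max_last up p).
(* Maximum last but one: it is the first item that is not rejected. *)
have H1 : (nb_avoids up p.+1 <= #|[set s |
   (insert_max (widen_ord (leqnSn p.+1) ord_max) s \in W p.+2 p)
   && avoids up (insert_max (widen_ord (leqnSn p.+1) ord_max) s)]|)%N.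
  apply/subset_leq_card/subsetP => s; rewrite [_ \in _]inE => avs.
  rewrite inE avoids_insert_max avs tail_avoids_short // !andbT.
  apply: (@mem_W _ _ _ (widen_ord (leqnSn p.+1) ord_max)) => //.
    by rewrite insert_max_at.
  by move=> j /=; lia.
(* Maximum last: the item before it is dominated by one of the rejected items,
   unless it is the maximum of the first p + 1 items. *)
have H2 : (nb_avoids up p.+1 <= #|[set s : 'S_p.+1 |
   (insert_max ord_max s \in W p.+2 p) && avoids up (insert_max ord_max s)]|
   + #|[set s : 'S_p.+1 | avoids up s && (s ord_max == ord_max)]|)%N.
  rewrite -[X in (_ <= X)%N]cardsUI; apply: leq_trans (leq_addr _ _).
  apply/subset_leq_card/subsetP => s; rewrite [_ \in _]inE => avs.
  rewrite in_setU [in X in _ || X]inE avs [in X in X || _]inE.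
  rewrite avoids_insert_max avs tail_avoids_short //= andbT orbC -implyNb; apply/implyP => sp.
  apply: (@mem_W _ _ _ ord_max) => //; first by rewrite insert_max_at.
  move=> j /= jp; have -> : j = lift ord_max ord_max.
    by apply: ord_inj; rewrite lift_max /=; lia.
  (* The dominating item is the maximum of the first p + 1 items. *)
  have sV : s (s^-1%g ord_max) = ord_max by rewrite permKV.
  exists (lift ord_max (s^-1%g ord_max)).
    rewrite lift_max ltn_neqAle -ltnS ltn_ord andbT; apply: contraNneq sp => E.
    by rewrite -{2}sV; apply/eqP; congr (s _); apply: val_inj.
  by rewrite !insert_max_lift sV ltn_neqAle -ltnS ltn_ord andbT.
rewrite mul2n -addnn; apply: leq_trans (leq_add H1 H2) _.
by rewrite addnA !leq_add2r leq_addl.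
Qed.

(** * The limit inferior *)

Lemma limn_einf_ge (R : realType) (x : \bar R) (u : nat -> \bar R) N :
  (forall n, (N <= n)%N -> (x <= u n)%E) -> (x <= limn_einf u)%E.
Proof.
move=> H; rewrite limn_einf_lim; apply: lime_ge; first exact: is_cvg_einfs.
exists N => // n /= Nn; apply: le_ereal_inf_tmp => _ [k /= nk <-].
by apply: H; apply: leq_trans nk.
Qed.

Unset Implicit Arguments.

Theorem proposition4 (R : realType) (eta : 'S_3)
  (Heta : one_line eta = [:: 3; 2; 1]%N \/ one_line eta = [:: 3; 1; 2]%N) :
  ((7 / 16 : R)%:E <=
   limn_einf (fun n : nat => (\big[Num.max/0]_(M < n) Pav R eta (W n M))%:E))%E.
Proof.
have [up Hup] : exists up : bool, one_line eta = [:: 3; (~~ up).+1; up.+1]%N.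
  by case: Heta => ->; [exists false | exists true].
have SavE n : Sav n eta = [set s | avoids up s].
  by apply/setP => s; rewrite !inE (containsE s Hup) negbK.
apply: (@limn_einf_ge _ _ _ 2) => -[|[|p]] // _; rewrite lee_fin.
have pn : (p < p.+2)%N by lia.
apply: (bigmax_sup (Ordinal pn)) => //=.
rewrite /Pav SavE -/(nb_avoids up p.+2).
have c_gt0 : 0 < (nb_avoids up p.+2)%:R :> R by rewrite ltr0n nb_avoids_gt0.
rewrite ler_pdivlMr // mulrAC ler_pdivrMr // -!natrM ler_nat.
by have := nb_avoids_lower_bound up p; have := card_W_ge up p; lia.
Qed.
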